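(* Let $G = \langle a,b,c,d \rangle$ be the first Grigorchuk group with its standard generators and let $K$ be a finite field. Then the element $p = ada + dad + c$ of the group ring $K[G]$ has infinite multiplicative order. In particular, $K^G$ admits a linear cellular automaton of infinite order.
   Context: The first Grigorchuk group is the group of permutations of $\{0,1\}^{\mathbb{N}}$ generated by the commonly used involutions $a,b,c,d$: $a$ flips the first symbol, and $b,c,d$ fix the first symbol and are given recursively by $b = (a,c)$, $c = (a,d)$, $d = (1,b)$, where the two entries describe the action on the remaining sequence according to the value of the first symbol. In the labeling convention of the paper, the Schreier graph of the orbit of $111\ldots$ is a one-ended path starting at the vertex $111\ldots$, at which $b,c,d$ are loops. An element $p$ of a ring has infinite multiplicative order if its powers are pairwise distinct, i.e. $p^n \neq p^m$ for all $0 \leq n < m$. $K^G$ has the product topology, the left shift action $(gx)_h = x_{g^{-1}h}$ and the cellwise $K$-vector space operations. A linear cellular automaton on $K^G$ is a continuous $K$-linear map $f : K^G \to K^G$ commuting with the shift action; it has infinite order if its powers are pairwise distinct. Linear cellular automata on $K^G$ correspond to elements of the group ring $K[G]$, with composition corresponding to multiplication. *)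

(* Defs.v *)
From HB Require Import structures.
From mathcomp Require Import all_boot all_order all_algebra finmap.
From mathcomp Require Import monalg.
From mathcomp Require Import boolp classical_sets functions.
From mathcomp Require Import topology.

Set Implicit Arguments.
Unset Strict Implicit.
Unset Printing Implicit Defensive.

Import GRing.Theory.

Local Open Scope ring_scope.

(* The product f * g is "g first, then f", so that groups of permutations act
   on the left. *)
Record Sym (T : Type) : Type :=
  SymMk { sym_fun :> T -> T; _ : `[< bijective sym_fun >] }.

Section Sym.
Variable T : Type.
Implicit Types f g h : Sym T.

HB.instance Definition _ := [isSub of Sym T for @sym_fun T].
HB.instance Definition _ := gen_eqMixin (Sym T).
HB.instance Definition _ := gen_choiceMixin (Sym T).

Lemma Sym_bij f : bijective f.
Proof. exact/asboolP/(valP f). Qed.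

Definition Sym_of (f : T -> T) (bij_f : bijective f) : Sym T :=
  SymMk (asboolT bij_f).

Let one : Sym T := Sym_of (@inv_bij T id (fun=> erefl)).

Let mul f g : Sym T := Sym_of (bij_comp (Sym_bij f) (Sym_bij g)).

Lemma Sym_inv_ex f : exists g : T -> T, cancel f g /\ cancel g f.
Proof. by have [g fK gK] := Sym_bij f; exists g. Qed.

Let invf f : T -> T := projT1 (cid (Sym_inv_ex f)).

Let invfP f : cancel f (invf f) /\ cancel (invf f) f.
Proof. by rewrite /invf; case: cid. Qed.

Let inv f : Sym T := Sym_of (Bijective (invfP f).2 (invfP f).1).

Let mulA : associative mul.
Proof. by move=> f g h; apply/val_inj. Qed.

Let mul1 : left_id one mul.
Proof. by move=> f; apply/val_inj. Qed.

Let mulo1 : right_id one mul.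
Proof. by move=> f; apply/val_inj. Qed.

Let mulV : left_inverse one inv mul.
Proof. by move=> f; apply/val_inj/funext => x; exact: (invfP f).1. Qed.

Let mulfV : right_inverse one inv mul.
Proof. by move=> f; apply/val_inj/funext => x; exact: (invfP f).2. Qed.

HB.instance Definition _ := isGroup.Build (Sym T) mulA mul1 mulo1 mulV mulfV.

End Sym.

Definition generated (H : groupType) (s : seq H) : {pred H} :=
  fun x => `[< forall A : {pred H}, group_closed A -> {subset s <= A} ->
                 x \in A >].

Section Generated.
Variables (H : groupType) (s : seq H).

Lemma generated_group_closed : group_closed (generated s).
Proof.
split=> [|x y /asboolP xs /asboolP ys]; apply/asboolP => A clA sA.
  exact: clA.1.
by apply: clA.2; [exact: xs | exact: ys].
Qed.

Lemma mem_generated x : x \in s -> x \in generated s.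
Proof. by move=> xs; apply/asboolP => A _; exact. Qed.

End Generated.

(* The symbols 0 and 1 are false and true. *)
Definition scons (e : bool) (w : nat -> bool) : nat -> bool :=
  fun n => if n is m.+1 then w m else e.

Definition shead (w : nat -> bool) : bool := w 0%N.

Definition stail (w : nat -> bool) : nat -> bool := fun n => w n.+1.

Definition act_a (w : nat -> bool) : nat -> bool :=
  scons (~~ shead w) (stail w).

(* act_b_at n w is the n-th symbol of b w, and likewise for c, d; the recursive
   equations b = (a, c), c = (a, d), d = (1, b) are the lemmas act_bE, act_cE
   and act_dE below. *)
Fixpoint act_b_at (n : nat) (w : nat -> bool) : bool :=
  if n is m.+1 then
    if shead w then act_c_at m (stail w) else act_a (stail w) m
  else shead w
with act_c_at (n : nat) (w : nat -> bool) : bool :=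
  if n is m.+1 then
    if shead w then act_d_at m (stail w) else act_a (stail w) m
  else shead w
with act_d_at (n : nat) (w : nat -> bool) : bool :=
  if n is m.+1 then
    if shead w then act_b_at m (stail w) else stail w m
  else shead w.

Definition act_b (w : nat -> bool) : nat -> bool := act_b_at^~ w.
Definition act_c (w : nat -> bool) : nat -> bool := act_c_at^~ w.
Definition act_d (w : nat -> bool) : nat -> bool := act_d_at^~ w.

Lemma act_aE e w : act_a (scons e w) = scons (~~ e) w.
Proof. by []. Qed.

Lemma act_bE e w :
  act_b (scons e w) = scons e (if e then act_c w else act_a w).
Proof. by apply/funext => -[|n] //; case: e. Qed.

Lemma act_cE e w :
  act_c (scons e w) = scons e (if e then act_d w else act_a w).
Proof. by apply/funext => -[|n] //; case: e. Qed.

Lemma act_dE e w :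
  act_d (scons e w) = scons e (if e then act_b w else w).
Proof. by apply/funext => -[|n] //; case: e. Qed.

Lemma sconsK w : scons (shead w) (stail w) = w.
Proof. by apply/funext => -[]. Qed.

Lemma act_a_invol : involutive act_a.
Proof. by move=> w; rewrite -[w]sconsK !act_aE negbK. Qed.

Lemma act_bcd_invol :
  [/\ involutive act_b, involutive act_c & involutive act_d].
Proof.
suff inv_at n : forall w, [/\ act_b (act_b w) n = w n,
    act_c (act_c w) n = w n & act_d (act_d w) n = w n].
  by split=> w; apply/funext => n; have [] := inv_at n w.
elim: n => [|n IHn] w; rewrite -[w]sconsK; first by split.
have [IHb IHc IHd] := IHn (stail w).
rewrite !(act_bE, act_cE, act_dE) /=; case: (shead w) => //.
by rewrite act_a_invol.
Qed.

Lemma act_b_invol : involutive act_b. Proof. by case: act_bcd_invol. Qed.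
Lemma act_c_invol : involutive act_c. Proof. by case: act_bcd_invol. Qed.
Lemma act_d_invol : involutive act_d. Proof. by case: act_bcd_invol. Qed.

Definition sym_a : Sym (nat -> bool) := Sym_of (inv_bij act_a_invol).
Definition sym_b : Sym (nat -> bool) := Sym_of (inv_bij act_b_invol).
Definition sym_c : Sym (nat -> bool) := Sym_of (inv_bij act_c_invol).
Definition sym_d : Sym (nat -> bool) := Sym_of (inv_bij act_d_invol).

Definition grigorchuk_gens : seq (Sym (nat -> bool)) :=
  [:: sym_a; sym_b; sym_c; sym_d].

Record grigorchuk : Type := Grigorchuk {
  grigorchuk_val :> Sym (nat -> bool);
  _ : grigorchuk_val \in generated grigorchuk_gens
}.

HB.instance Definition _ := [isSub of grigorchuk for grigorchuk_val].
HB.instance Definition _ := [Choice of grigorchuk by <:].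
HB.instance Definition _ :=
  SubChoice_isSubGroup.Build _ _ grigorchuk
    (generated_group_closed grigorchuk_gens).

Fact grig_a_subproof : sym_a \in generated grigorchuk_gens.
Proof. by apply: mem_generated; rewrite !inE eqxx. Qed.
Fact grig_b_subproof : sym_b \in generated grigorchuk_gens.
Proof. by apply: mem_generated; rewrite !inE eqxx !orbT. Qed.
Fact grig_c_subproof : sym_c \in generated grigorchuk_gens.
Proof. by apply: mem_generated; rewrite !inE eqxx !orbT. Qed.
Fact grig_d_subproof : sym_d \in generated grigorchuk_gens.
Proof. by apply: mem_generated; rewrite !inE eqxx !orbT. Qed.

Definition grig_a : grigorchuk := Sub sym_a grig_a_subproof.
Definition grig_b : grigorchuk := Sub sym_b grig_b_subproof.
Definition grig_c : grigorchuk := Sub sym_c grig_c_subproof.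
Definition grig_d : grigorchuk := Sub sym_d grig_d_subproof.

(* {malg R[G]} is the additive group of finitely supported functions G -> R,
   with << r *g x >> the function r at x and 0 elsewhere; the ring structure
   that monalg puts on it is restricted to monoids without nontrivial units,
   hence the alias. *)
Definition groupRing (R : nzRingType) (G : groupType) : Type := {malg R[G]}.

Section GroupRing.
Variables (R : nzRingType) (G : groupType).

HB.instance Definition _ := GRing.Zmodule.on (groupRing R G).

Implicit Types (u v w : groupRing R G) (x y : G) (r t : R).

Definition groupRing_elt x : groupRing R G := << 1 *g x >>.

Definition groupRing_mul u v : groupRing R G :=
  \sum_(x <- msupp u) \sum_(y <- msupp v) << u@_x * v@_y *g (x * y)%g >>.

Local Notation mul := groupRing_mul.
Local Notation one := (groupRing_elt 1%g).

Let mulw (D E : {fset G}) u v :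
  (msupp u `<=` D)%fset -> (msupp v `<=` E)%fset ->
  mul u v = \sum_(x <- D) \sum_(y <- E) << u@_x * v@_y *g (x * y)%g >>.
Proof.
move=> uD vE; rewrite /mul (big_fset_incl _ uD) /= => [|x _ /mcoeff_outdom ->].
  apply: eq_bigr => x _; apply: big_fset_incl => // y _ /mcoeff_outdom ->.
  by rewrite mulr0 monalgU0.
by rewrite big1 // => y _; rewrite mul0r monalgU0.
Qed.

Let mul0 : left_zero 0 mul.
Proof. by move=> u; rewrite /mul msupp0 big_seq_fset0. Qed.

Let mulo0 : right_zero 0 mul.
Proof. by move=> u; rewrite /mul big1 // => x _; rewrite msupp0 big_seq_fset0. Qed.

Let mulUg r x u :
  mul << r *g x >> u = \sum_(y <- msupp u) << r * u@_y *g (x * y)%g >>.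
Proof.
rewrite (mulw msuppU_le (fsubset_refl _)) big_seq_fset1.
by apply: eq_bigr => y _; rewrite mcoeffUU.
Qed.

Let mulgU r x u :
  mul u << r *g x >> = \sum_(y <- msupp u) << u@_y * r *g (y * x)%g >>.
Proof.
rewrite (mulw (fsubset_refl _) msuppU_le).
by apply: eq_bigr => y _; rewrite big_seq_fset1 mcoeffUU.
Qed.

Let mulUU r t x y : mul << r *g x >> << t *g y >> = << r * t *g (x * y)%g >>.
Proof. by rewrite (mulw msuppU_le msuppU_le) !big_seq_fset1 !mcoeffUU. Qed.

Let mulDl : left_distributive mul +%R.
Proof.
move=> u v w.
have sw := fsubset_refl (msupp w).
rewrite (mulw (msuppD_le u v) sw) (mulw (fsubsetUl _ (msupp v)) sw).
rewrite (mulw (fsubsetUr (msupp u) _) sw) -big_split; apply: eq_bigr => x _.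
by rewrite -big_split; apply: eq_bigr => y _; rewrite mcoeffD mulrDl monalgUD.
Qed.

Let mulDr : right_distributive mul +%R.
Proof.
move=> u v w.
have su := fsubset_refl (msupp u).
rewrite (mulw su (msuppD_le v w)) (mulw su (fsubsetUl _ (msupp w))).
rewrite (mulw su (fsubsetUr (msupp v) _)) -big_split; apply: eq_bigr => x _.
by rewrite -big_split; apply: eq_bigr => y _; rewrite mcoeffD mulrDr monalgUD.
Qed.

Let mul1 : left_id one mul.
Proof.
move=> u; rewrite mulUg [RHS]monalgE.
by apply: eq_bigr => x _; rewrite mul1r mul1g.
Qed.

Let mulo1 : right_id one mul.
Proof.
move=> u; rewrite mulgU [RHS]monalgE.
by apply: eq_bigr => x _; rewrite mulr1 mulg1.
Qed.

Let mul_suml I (s : seq I) (F : I -> groupRing R G) u :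
  mul (\sum_(i <- s) F i) u = \sum_(i <- s) mul (F i) u.
Proof. exact: (big_morph (mul^~ u) (fun v w => mulDl v w u) (mul0 u)). Qed.

Let mul_sumr I (s : seq I) (F : I -> groupRing R G) u :
  mul u (\sum_(i <- s) F i) = \sum_(i <- s) mul u (F i).
Proof. exact: (big_morph (mul u) (mulDr u) (mulo0 u)). Qed.

Let mulA : associative mul.
Proof.
move=> u v w; rewrite [u]monalgE !(mul_suml (msupp u)); apply: eq_bigr => x _.
rewrite [v]monalgE !(mul_suml (msupp v), mul_sumr (msupp v)); apply: eq_bigr => y _.
rewrite [w]monalgE !(mul_sumr (msupp w)); apply: eq_bigr => z _.
by rewrite !mulUU mulrA mulgA.
Qed.

Let one_neq0 : one != 0.
Proof. by rewrite monalgU_eq0 oner_eq0. Qed.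

HB.instance Definition _ := GRing.Zmodule_isNzRing.Build (groupRing R G)
  mulA mul1 mulo1 mulDl mulDr one_neq0.

Lemma groupRing_eltM x y :
  groupRing_elt (x * y)%g = groupRing_elt x * groupRing_elt y.
Proof. by rewrite /groupRing_elt [RHS]mulUU mulr1. Qed.

End GroupRing.

Definition infinite_order (R : pzRingType) (p : R) : Prop :=
  forall n m : nat, (n < m)%N -> p ^+ n <> p ^+ m.

Section LinearCA.
Variables (K : fieldType) (G : groupType).

Definition shift (g : G) (x : G -> K) : G -> K := fun h => x (g^-1 * h)%g.

(* K^G carries two library structures, given on two convertible types: the
   product topology of the discrete topology of K, and the cellwise K-vector
   space structure, K^o being K as a vector space over itself. *)
Record linear_ca (f : (G -> K) -> (G -> K)) : Prop := LinearCA {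
  linear_ca_continuous :
    continuous (f : {ptws G -> discrete_topology K} ->
                    {ptws G -> discrete_topology K});
  linear_ca_linear : linear (f : (G -> K^o) -> (G -> K^o));
  linear_ca_shift : forall g x, f (shift g x) = shift g (f x)
}.

Definition ca_infinite_order (f : (G -> K) -> (G -> K)) : Prop :=
  forall n m : nat, (n < m)%N -> iter n f <> iter m f.

End LinearCA.

(* Main.v *)
Require Import Defs.
From mathcomp Require Import all_boot all_algebra finmap monalg.
From mathcomp Require Import boolp classical_sets functions topology.
From mathcomp Require Import zify.

(** The Schreier graph of the orbit of v_0 = 111... is a path v_0, v_1, v_2, ...
    in which a exchanges v_2k and v_(2k+1), while each of b, c, d either
    exchanges v_(2k-1) and v_2k or fixes both, depending on the 2-adic valuation
    of k modulo 3; exactly one of the three fixes them.  Hence p acts on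
    finitely supported functions on the path.  If the rightmost vertex m of the
    support is v_0 or is incident to an edge fixed by d, then exactly one of the
    three terms of p reaches the rightmost vertex of the image, from m only, and
    that vertex is again of this kind.  So p moves the right end of the support
    strictly to the right with coefficient 1, and the p^n v_0 are pairwise
    distinct, whatever the coefficients. *)

Set Implicit Arguments.
Unset Strict Implicit.
Unset Printing Implicit Defensive.

Import GRing.Theory.

(** * The orbit of 111... as a path *)

(* Each symbol negates a digit of the binary reflected Gray code of m. *)
Definition sch_vertex (m : nat) : nat -> bool :=
  fun i => ~~ (odd (iter i half m) (+) odd (iter i.+1 half m)).

Definition step_a (m : nat) : nat := if odd m then m.-1 else m.+1.

(* Edge k joins the vertices 2k-1 and 2k; the type t is 0 for d, 1 for c, 2 for b.
   Since logn 2 0 = 0, the fictitious edge 0 at the end of the path counts as a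
   loop of d. *)
Definition loop_edge (t k : nat) : bool := logn 2 k %% 3 == t.

Definition step_bcd (t m : nat) : nat :=
  if loop_edge t (uphalf m) then m else if odd m then m.+1 else m.-1.

Lemma sch_vertexE m :
  sch_vertex m = scons (~~ (odd m (+) odd m./2)) (sch_vertex m./2).
Proof. by apply/funext => -[|i] //=; rewrite /sch_vertex -!iterSr. Qed.

Lemma sch_vertex_half m n : sch_vertex m = sch_vertex n ->
  sch_vertex m./2 = sch_vertex n./2 /\
  odd m (+) odd m./2 = odd n (+) odd n./2.
Proof.
rewrite [LHS]sch_vertexE [RHS]sch_vertexE => eq_v; split.
  by apply/funext => i; exact: (congr1 (@^~ i.+1) eq_v).
exact/negb_inj/(congr1 (@^~ 0) eq_v).
Qed.

(** By induction on [m + n]: equal tails give equal halves, and the first symbol then fixes the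
    parity. *)
Lemma sch_vertex_inj : injective sch_vertex.
Proof.
suff inj_lt N m n : (m + n < N)%N -> sch_vertex m = sch_vertex n -> m = n.
  by move=> m n; exact: inj_lt (ltnSn _).
elim: N m n => // N IHN m n mnN /sch_vertex_half [eq_v eq_h].
have [mn0|mn_gt0] := posnP (m + n); first by lia.
have eq_half : m./2 = n./2 by apply: IHN => //; lia.
by lia.
Qed.

Lemma act_a_vertex m : act_a (sch_vertex m) = sch_vertex (step_a m).
Proof.
rewrite (sch_vertexE m) act_aE [RHS]sch_vertexE /step_a.
by case: ifP => om; congr (scons _ (sch_vertex _)); lia.
Qed.

Lemma loop_edge_odd t k : odd k -> loop_edge t k = (t == 0).
Proof. by move=> ok; rewrite /loop_edge logn_coprime ?coprime2n // eq_sym. Qed.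

(** Doubling raises the valuation by one and so shifts the types cyclically, as the recursion for
    [b], [c], [d] does after a first symbol 1. *)
Lemma loop_edge_double k :
  (0 < k)%N -> [/\ loop_edge 0 k.*2 = loop_edge 2 k,
    loop_edge 1 k.*2 = loop_edge 0 k & loop_edge 2 k.*2 = loop_edge 1 k].
Proof.
move=> k_gt0; rewrite /loop_edge -mul2n lognM // logn_prime //=.
by split; lia.
Qed.

Lemma step_bcd_half0 t m : odd m (+) odd m./2 ->
  (step_bcd t m)./2 = if t == 0 then m./2 else step_a m./2.
Proof.
move=> h; rewrite /step_bcd loop_edge_odd /step_a; last by lia.
by case: (t == 0) => //; case: ifP; case: ifP; lia.
Qed.

Lemma step_bcd_half1 m : ~~ (odd m (+) odd m./2) ->
  [/\ (step_bcd 0 m)./2 = step_bcd 2 m./2,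
      (step_bcd 1 m)./2 = step_bcd 0 m./2
    & (step_bcd 2 m)./2 = step_bcd 1 m./2].
Proof.
(* At vertex 0, edge 0 gives the loop of [d], and [0.-1 = 0] those of [b] and [c]. *)
move=> h; have [->|m_gt0] := posnP m; first by [].
have uE : uphalf m = (uphalf m./2).*2 by lia.
have [] := @loop_edge_double (uphalf m./2); first by lia.
rewrite /step_bcd uE => -> -> ->.
by split; case: ifP => // _; case: ifP; case: ifP; lia.
Qed.

Lemma step_bcd_head t m :
  odd (step_bcd t m) (+) odd (step_bcd t m)./2 = odd m (+) odd m./2.
Proof.
by rewrite /step_bcd; case: ifP => // _; case: ifP; have [->|] := posnP m; lia.
Qed.

Lemma act_bcd_vertex m :
  [/\ act_d (sch_vertex m) = sch_vertex (step_bcd 0 m),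
      act_c (sch_vertex m) = sch_vertex (step_bcd 1 m)
    & act_b (sch_vertex m) = sch_vertex (step_bcd 2 m)].
Proof.
suff at_i i : forall m,
    [/\ act_d (sch_vertex m) i = sch_vertex (step_bcd 0 m) i,
        act_c (sch_vertex m) i = sch_vertex (step_bcd 1 m) i
      & act_b (sch_vertex m) i = sch_vertex (step_bcd 2 m) i].
  by split; apply/funext => i; have [] := at_i i m.
elim: i => [|i IHi] {}m.
  by split; rewrite [in RHS]sch_vertexE /= step_bcd_head.
have [IHd IHc IHb] := IHi m./2.
rewrite !(sch_vertexE m) !(act_bE, act_cE, act_dE).
rewrite !(sch_vertexE (step_bcd _ _)) /=.
case: (boolP (odd m (+) odd m./2)) => h /=.
  by rewrite !step_bcd_half0 //= act_a_vertex.
by have [-> -> ->] := step_bcd_half1 h.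
Qed.

(** * How [ada], [dad] and [c] move the right end *)

Local Notation step_d := (step_bcd 0).
Local Notation step_c := (step_bcd 1).

Definition step_ada m := step_a (step_d (step_a m)).
Definition step_dad m := step_d (step_a (step_d m)).

(** Of two consecutive edges one is odd, and odd edges are loops of [d]. *)
Lemma loop_edge_d_next k : ~~ loop_edge 0 k -> loop_edge 0 k.+1.
Proof.
by move=> h; rewrite loop_edge_odd //=; apply: contra h => ok;
   rewrite loop_edge_odd.
Qed.

Lemma loop_edge_d_c k : loop_edge 0 k -> ~~ loop_edge 1 k.
Proof. by rewrite /loop_edge => /eqP ->. Qed.

(** For [m] at a loop of [d]: if [m] is odd, [c] reaches [m + 1]; if [m] is even, [dad] reaches
    [m + 1] when the next edge is a loop of [d], and [ada] reaches [m + 3] otherwise. *)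
Definition next_lead (m : nat) : nat :=
  if odd m || loop_edge 0 m./2.+1 then m.+1 else m.+3.

Lemma step_aE i : (step_a i.*2 = i.*2.+1) * (step_a i.*2.+1 = i.*2).
Proof. by rewrite /step_a; split; case: ifP; lia. Qed.

Lemma step_bcdE t i :
  (step_bcd t i.*2 = if loop_edge t i then i.*2 else i.*2.-1) *
  (step_bcd t i.*2.+1 = if loop_edge t i.+1 then i.*2.+1 else i.*2.+2).
Proof.
rewrite /step_bcd /= uphalf_double doubleK odd_double /=.
by split; case: ifP.
Qed.

Lemma step_bcd_le t i : (step_bcd t i.*2 <= i.*2)%N.
Proof. by rewrite step_bcdE; case: ifP; lia. Qed.

Lemma step_ada_even i :
  step_ada i.*2 = if loop_edge 0 i.+1 then i.*2 else i.*2.+3.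
Proof.
rewrite /step_ada step_aE step_bcdE; case: ifP => _; rewrite ?step_aE //.
by rewrite -doubleS step_aE.
Qed.

Lemma step_ada_odd i : (step_ada i.*2.+1 <= i.*2.+1)%N.
Proof.
rewrite /step_ada step_aE step_bcdE; case: ifP => _; rewrite ?step_aE //.
by rewrite /step_a; case: ifP; lia.
Qed.

Lemma step_dad_even i : (step_dad i.*2 <=
  if loop_edge 0 i then if loop_edge 0 i.+1 then i.*2.+1 else i.*2.+2
  else i.*2)%N.
Proof.
rewrite /step_dad step_bcdE; case: ifP => h.
  by rewrite step_aE step_bcdE; case: ifP.
case: i h => // i _; rewrite doubleS /= step_aE.
by apply: leq_trans (step_bcd_le _ _) _; lia.
Qed.

Lemma step_dad_even_eq i : loop_edge 0 i ->
  step_dad i.*2 = if loop_edge 0 i.+1 then i.*2.+1 else i.*2.+2.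
Proof. by move=> h; rewrite /step_dad step_bcdE h step_aE step_bcdE. Qed.

Lemma step_dad_odd i :
  (step_dad i.*2.+1 <= if loop_edge 0 i.+1 then i.*2 else i.*2.+3)%N.
Proof.
rewrite /step_dad step_bcdE; case: ifP => h.
  by rewrite step_aE step_bcd_le.
by rewrite -doubleS step_aE step_bcdE loop_edge_d_next ?h.
Qed.

Lemma step_c_odd i :
  step_c i.*2.+1 = if loop_edge 1 i.+1 then i.*2.+1 else i.*2.+2.
Proof. by rewrite step_bcdE. Qed.

Lemma parity_ind (P : nat -> Prop) :
  (forall i, P i.*2) -> (forall i, P i.*2.+1) -> forall m, P m.
Proof.
move=> Pe Po m; rewrite -(odd_double_half m).
by case: (odd m); [exact: Po | exact: Pe].
Qed.

Lemma next_lead_step m : loop_edge 0 (uphalf m) ->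
  loop_edge 0 (uphalf (next_lead m)).
Proof.
rewrite /next_lead; elim/parity_ind: m => i.
  rewrite odd_double doubleK orFb => _; case: ifPn => h.
    by have -> : uphalf i.*2.+1 = i.+1 by lia.
  by have -> : uphalf i.*2.+3 = i.+2 by [lia]; rewrite loop_edge_d_next.
rewrite oddS odd_double orTb.
by have -> : uphalf i.*2.+2 = uphalf i.*2.+1 by lia.
Qed.

(** All three terms send [2i] and [2i+1] to at most [2i+3]. This suffices unless edge [i+1] is the
    one at [m]; then its being a loop of [d] gives sharper bounds. *)
Lemma step_lt_next_lead m j : loop_edge 0 (uphalf m) -> (j < m)%N ->
  [/\ (step_ada j < next_lead m)%N, (step_dad j < next_lead m)%N
    & (step_c j < next_lead m)%N].
Proof.
rewrite /next_lead; elim/parity_ind: m => k /=;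
  rewrite ?odd_double ?doubleK ?uphalf_double /= => hk;
  elim/parity_ind: j => i ji.
- have := step_bcd_le 1 i; have := step_dad_even i; rewrite step_ada_even.
  have [ik|ik] : i.+1 = k \/ (i.+1 < k)%N by lia.
    by subst k; rewrite hk; case: ifP; case: ifP; split; lia.
  by repeat case: ifP; split; lia.
- have := step_ada_odd i; have := step_dad_odd i; rewrite step_c_odd.
  have [ik|ik] : i.+1 = k \/ (i.+1 < k)%N by lia.
    by subst k; rewrite hk; repeat case: ifP; split; lia.
  by repeat case: ifP; split; lia.
- have := step_bcd_le 1 i; have := step_dad_even i; rewrite step_ada_even.
  have [ik|ik] : i = k \/ (i < k)%N by lia.
    by subst k; rewrite hk; case: ifP; split; lia.
  by repeat case: ifP; split; lia.
- have := step_ada_odd i; have := step_dad_odd i; rewrite step_c_odd.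
  by repeat case: ifP; split; lia.
Qed.

Lemma step_next_lead m : loop_edge 0 (uphalf m) ->
  [\/ [/\ step_ada m = next_lead m, (step_dad m < next_lead m)%N
        & (step_c m < next_lead m)%N],
      [/\ (step_ada m < next_lead m)%N, step_dad m = next_lead m
        & (step_c m < next_lead m)%N]
    | [/\ (step_ada m < next_lead m)%N, (step_dad m < next_lead m)%N
        & step_c m = next_lead m]].
Proof.
rewrite /next_lead; elim/parity_ind: m => k /=;
  rewrite ?odd_double ?doubleK ?uphalf_double /= => hk.
  have := step_bcd_le 1 k; rewrite step_ada_even step_dad_even_eq //.
  by case: ifP => _ ?; [apply: Or32 | apply: Or31]; split; lia.
apply: Or33; have := step_ada_odd k; have := step_dad_odd k.
by rewrite step_c_odd hk (negPf (loop_edge_d_c hk)); split; lia.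
Qed.

Lemma ltn_next_lead m : (m < next_lead m)%N.
Proof. by rewrite /next_lead; case: ifP; lia. Qed.

Local Open Scope ring_scope.

(* path_op is the transpose of p: iterating it at vertex 0 pairs u with p^n v_0,
   which is supported in [0, L_n] with coefficient 1 at
   L_n := iter n next_lead 0. *)
Definition path_op (V : nmodType) (u : nat -> V) (m : nat) : V :=
  u (step_ada m) + u (step_dad m) + u (step_c m).

(** If [u] vanishes below [L_(n+1)], then [path_op u] vanishes below [L_n], and its value at [L_n]
    is that of [u] at [L_(n+1)]. *)
Lemma iter_path_op (V : nmodType) (n : nat) (u : nat -> V) :
  (forall j, (j < iter n next_lead 0)%N -> u j = 0) ->
  iter n (@path_op V) u 0%N = u (iter n next_lead 0%N).
Proof.
have lead k : loop_edge 0 (uphalf (iter k next_lead 0)).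
  by elim: k => //= k; exact: next_lead_step.
elim: n u => [|n IHn] u //= u0; rewrite -iterS iterSr IHn => [|j].
  rewrite /path_op; have [] := step_next_lead (lead n) => -[];
    by do 3![move=> /u0 -> || move=> ->]; rewrite ?addr0 ?add0r.
move=> /(step_lt_next_lead (lead n)) [? ? ?].
by rewrite /path_op !u0 // !addr0.
Qed.

(** * Sums of translates as linear cellular automata *)

Definition sum_translates (K : nmodType) (G : groupType) (s : seq G)
    (x : G -> K) : G -> K :=
  fun h => \sum_(g <- s) x (h * g)%g.

(** Agreement with [x] on finitely many cells defines a neighbourhood of [x], so every cell of [f x]
    is locally constant in [x]. *)
Lemma local_rule_continuous (K : choiceType) (G : choiceType)
    (f : (G -> K) -> (G -> K)) (s : G -> seq G) :
  (forall h x y, {in s h, x =1 y} -> f x h = f y h) ->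
  continuous (f : {ptws G -> discrete_topology K} ->
                  {ptws G -> discrete_topology K}).
Proof.
move=> f_local x.
have FF : Filter (nbhs (x : {ptws G -> discrete_topology K})).
  exact: nbhs_filter.
suff near_s (t : seq G) : nbhs (x : {ptws G -> discrete_topology K})
    [set y : G -> K | {in t, x =1 y}]%classic.
  apply/(@pointwise_cvgP (discrete_topology G) (discrete_topology K)) => h.
  have near_fx : nbhs (x : {ptws G -> discrete_topology K})
      [set y : G -> K | f y h = f x h]%classic.
    by apply: filterS (near_s (s h)) => y /f_local.
  exact: (@cvg_near_cst _ (discrete_topology K) (f x h)
            (fun y : G -> K => f y h) _ FF near_fx).
elim: t => [|g t IHt].
  exact: (@filterS _ _ FF _ _ _ (@filterT _ _ FF)).
have near_g := @proj_continuous G (fun=> discrete_topology K) g x _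
  (@discrete_set1 (discrete_topology K) (x g)).
apply: (@filterS _ _ FF _ _ _ (@filterI _ _ FF _ _ near_g IHt)).
move=> y [/= yg yt] k.
by rewrite inE => /predU1P [->|/yt].
Qed.

Lemma sum_translates_linear_ca (K : fieldType) (G : groupType) (s : seq G) :
  linear_ca (@sum_translates K G s).
Proof.
split.
- apply: (@local_rule_continuous K G _ (fun h => [seq (h * g)%g | g <- s])).
  move=> h x y xy; apply: eq_big_seq => g gs.
  exact/xy/map_f.
- move=> k x y; apply/funext => h.
  transitivity ((k : K) * sum_translates s x h + sum_translates s y h : K) => //.
  by rewrite /sum_translates mulr_sumr -big_split.
- move=> g x; apply/funext => h; rewrite /shift /sum_translates.
  by apply: eq_bigr => k _; rewrite mulgA.
Qed.

(** * Duality between configurations and the group ring *)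

Section Pairing.
Variables (K : comNzRingType) (G : groupType).

(** The linear extension of [x] to the group ring; under it [sum_translates s] is the transpose of
    right multiplication by the sum of [s]. *)
Definition pairing (x : G -> K) (u : groupRing K G) : K := mmap idfun x u.

Lemma pairingD x : {morph pairing x : u v / u + v}.
Proof. exact: mmapD. Qed.

Lemma pairing_elt x g : pairing x (groupRing_elt K g) = x g.
Proof. by rewrite /pairing mmapU mul1r. Qed.

Lemma pairingM_elt x u g :
  pairing x (u * groupRing_elt K g) = pairing (fun h => x (h * g)%g) u.
Proof.
rewrite /GRing.mul /= /groupRing_mul.
rewrite /pairing raddf_sum /= [RHS]mmapE; apply: eq_bigr => h _.
by rewrite msuppU oner_eq0 big_seq_fset1 mmapU mcoeffUU mulr1.
Qed.

Lemma pairingM_sum x u (s : seq G) :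
  pairing x (u * \sum_(g <- s) groupRing_elt K g) =
  pairing (sum_translates s x) u.
Proof.
have pairing0 : pairing x 0 = 0 by exact: mmap0.
rewrite mulr_sumr (big_morph _ (pairingD x) pairing0).
under eq_bigr do rewrite pairingM_elt.
rewrite /pairing mmapE; under [in LHS]eq_bigr do rewrite mmapE.
by rewrite exchange_big; apply: eq_bigr => h _; rewrite -mulr_sumr.
Qed.

Lemma pairingX_sum x (s : seq G) n :
  pairing x ((\sum_(g <- s) groupRing_elt K g) ^+ n) =
  iter n (sum_translates s) x 1%g.
Proof.
elim: n x => [|n IHn] x; first exact: pairing_elt.
by rewrite exprSr pairingM_sum IHn iterSr.
Qed.

End Pairing.

(** * Restriction to the orbit of 111... and separation of powers *)

Lemma grig_invol : [/\ (grig_a^-1 = grig_a)%g, (grig_c^-1 = grig_c)%g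
  & (grig_d^-1 = grig_d)%g].
Proof.
have invV (g : grigorchuk) : involutive (g : _ -> _) -> (g^-1 = g)%g.
  move=> gK; apply: (mulgI g); rewrite mulgV; do 2!apply: val_inj.
  by apply/funext => w; rewrite /= [RHS]gK.
split; apply: invV.
- exact: act_a_invol.
- exact: act_c_invol.
- exact: act_d_invol.
Qed.

Definition glider_supp : seq grigorchuk :=
  [:: grig_a * grig_d * grig_a; grig_d * grig_a * grig_d; grig_c]%g.

Section Orbit.
Variable K : nmodType.
Implicit Types (phi : (nat -> bool) -> K) (w : nat -> bool).

(* The inverse turns the translations h |-> h * g of K^G into the action of g^-1
   on the orbit; the three elements of glider_supp are involutions. *)
Definition orbit_fun phi (h : grigorchuk) : K := phi ((h^-1)%g (sch_vertex 0)).

Definition glider_op phi w : K :=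
  phi (act_a (act_d (act_a w))) + phi (act_d (act_a (act_d w))) + phi (act_c w).

Lemma sum_translates_orbit_fun phi :
  sum_translates glider_supp (orbit_fun phi) = orbit_fun (glider_op phi).
Proof.
have [Va Vc Vd] := grig_invol.
apply/funext => h; rewrite /sum_translates !big_cons big_nil addr0 addrA.
by rewrite /orbit_fun !invgM Va Vc Vd.
Qed.

Lemma iter_sum_translates_orbit_fun phi n :
  iter n (sum_translates glider_supp) (orbit_fun phi) =
  orbit_fun (iter n glider_op phi).
Proof. by elim: n => //= n ->; exact: sum_translates_orbit_fun. Qed.

Lemma glider_op_vertex phi :
  glider_op phi \o sch_vertex = path_op (phi \o sch_vertex).
Proof.
apply/funext => m; rewrite /glider_op /path_op /=.
have act_d_vertex k : act_d (sch_vertex k) = sch_vertex (step_d k).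
  by have [] := act_bcd_vertex k.
have [_ -> _] := act_bcd_vertex m.
by rewrite !(act_a_vertex, act_d_vertex).
Qed.

Lemma iter_glider_op_vertex phi n :
  iter n glider_op phi \o sch_vertex = iter n (@path_op K) (phi \o sch_vertex).
Proof. by elim: n => //= n <-; exact: glider_op_vertex. Qed.

End Orbit.

Lemma iter_lead_lt n m : (n < m)%N ->
  (iter n next_lead 0 < iter m next_lead 0)%N.
Proof.
elim: m => // m IHm; rewrite ltnS leq_eqVlt => /predU1P [->|/IHm nm].
  exact: ltn_next_lead.
exact: ltn_trans nm (ltn_next_lead _).
Qed.

(** The witness is the indicator of the vertex [L m], pulled back to the group. For [k <= m], its
    [k]-th iterate at cell 1 is the indicator at [L k]: 1 for [k = m] and 0 for [k < m]. *)
Lemma sum_translates_separated (K : nzRingType) n m : (n < m)%N ->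
  exists x : grigorchuk -> K,
    iter n (sum_translates glider_supp) x 1%g <>
    iter m (sum_translates glider_supp) x 1%g.
Proof.
move=> nm; pose L k := iter k next_lead 0%N.
pose phi w : K := `[< w = sch_vertex (L m) >]%:R.
have phiE j : phi (sch_vertex j) = (j == L m)%:R.
  congr (nat_of_bool _)%:R; apply/asboolP/eqP => [|->] //.
  exact: sch_vertex_inj.
have iterE k : (k <= m)%N ->
    iter k (sum_translates glider_supp) (orbit_fun phi) 1%g = (L k == L m)%:R.
  move=> km; rewrite iter_sum_translates_orbit_fun /orbit_fun invg1.
  have -> : (1%g : grigorchuk) (sch_vertex 0) = sch_vertex 0 by [].
  rewrite -[LHS]/((iter k (@glider_op K) phi \o sch_vertex) 0%N).
  rewrite iter_glider_op_vertex iter_path_op /= ?phiE // => j jL.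
  rewrite phiE ltn_eqF //; apply: leq_trans jL _.
  by move: km; rewrite leq_eqVlt => /predU1P [->|/iter_lead_lt/ltnW].
exists (orbit_fun phi); rewrite !iterE ?(ltnW nm) // eqxx.
by rewrite ltn_eqF ?iter_lead_lt //; apply/nesym/eqP/oner_neq0.
Qed.

Theorem mainTheorem8 (K : finFieldType) :
  infinite_order
    (groupRing_elt K (grig_a * grig_d * grig_a)%g
     + groupRing_elt K (grig_d * grig_a * grig_d)%g
     + groupRing_elt K grig_c)
  /\ (exists f : (grigorchuk -> K) -> (grigorchuk -> K),
        linear_ca f /\ ca_infinite_order f).
Proof.
split.
  move=> n m /(@sum_translates_separated K) [x neq_x] eq_p; apply: neq_x.
  rewrite -!pairingX_sum !big_cons big_nil addr0 addrA.
  by congr pairing.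
exists (sum_translates glider_supp); split.
  exact: sum_translates_linear_ca.
move=> n m /(@sum_translates_separated K) [x neq_x] eq_f.
by rewrite eq_f in neq_x.
Qed.
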